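(* Let $k\geq 2$ be an integer with $k\neq 3$. Then the equation $x^{2}-(k^{2}-1)y^{2}=-4$ has no positive integer solutions $(x,y)$.
   Context: A positive integer solution is a pair $(x,y)$ of positive integers satisfying the equation. *)

(* Defs.v *)
From mathcomp Require Import all_boot all_order all_algebra.

(* Main.v *)
Require Import Defs.
From mathcomp Require Import all_boot all_order all_algebra.
From mathcomp Require Import zify ring.
Import Order.TTheory GRing.Theory Num.Theory.
Local Open Scope ring_scope.

(** The proof is Fermat's descent along the unit [k - sqrt (k^2 - 1)], of
    norm 1.  Multiplying [x + y sqrt (k^2 - 1)] by it preserves the norm
    [x^2 - (k^2 - 1) y^2] ([pell_unit_mul]) and turns the second coordinate
    into [k y - x].  When [x >= 0] and the norm is [-4], this new coordinate
    always satisfies [k y - x > 0], and [k y - x < y] means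
    [(k - 1)^2 y^2 < x^2 = (k^2 - 1) y^2 - 4], that is [(k - 1) y^2 > 2].
    For [k >= 2] the last inequality fails only at [(k, y) = (2, 1)], where
    [x^2 = -1], and at [(k, y) = (3, 1)], which gives the genuine solution
    [(2, 1)] of [x^2 - 8 y^2 = -4].  So for [k <> 3] the descent
    ([pell_neg4_descent]) never stops, which is absurd. *)

Lemma pell_unit_mul (R : comPzRingType) (k x y : R) :
  (k * x - (k ^+ 2 - 1) * y) ^+ 2 - (k ^+ 2 - 1) * (k * y - x) ^+ 2 =
  x ^+ 2 - (k ^+ 2 - 1) * y ^+ 2.
Proof. ring. Qed.

(** Both bounds compare [x] with a multiple of [y] through their squares,
    which the equation determines. *)
Lemma pell_neg4_descent (k x y : int) :
  2 <= k -> k <> 3 -> 0 <= x -> 0 < y ->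
  x ^+ 2 - (k ^+ 2 - 1) * y ^+ 2 = - 4 ->
  0 < k * y - x < y.
Proof.
move=> k_ge2 k_neq3 x_ge0 y_gt0 eq_xy.
have gap : 2 < (k - 1) * y ^+ 2.
  have [y_ge2 | y_lt2] := leP 2 y; first by nia.
  have y1 : y = 1 by lia.
  rewrite {}y1 in eq_xy *.
  have [k2 | k_neq2] := eqVneq k 2; last by lia.
  (* here the equation reads [x^2 = -1] *)
  by rewrite {}k2 in eq_xy; nia.
apply/andP; split.
  have : x ^+ 2 < (k * y) ^+ 2 by nia.
  by rewrite ltr_sqr ?nnegrE; nia.
have : ((k - 1) * y) ^+ 2 < x ^+ 2 by nia.
by rewrite ltr_sqr ?nnegrE; nia.
Qed.

(** The sign of [x] is free here because the descent step may produce a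
    negative first coordinate. *)
Lemma pell_neg4_no_solution (k x y : int) :
  2 <= k -> k <> 3 -> 0 < y ->
  x ^+ 2 - (k ^+ 2 - 1) * y ^+ 2 <> - 4.
Proof.
move=> k_ge2 k_neq3.
have [n] := ubnP `|y|%N; elim: n x y => // n IHn x y y_lt y_gt0 eq_xy.
rewrite -(real_normK (num_real x)) in eq_xy.
have /andP[y'_gt0 y'_lt] :=
  pell_neg4_descent _ _ _ k_ge2 k_neq3 (normr_ge0 x) y_gt0 eq_xy.
apply: (IHn (k * `|x| - (k ^+ 2 - 1) * y) (k * y - `|x|)) => //.
  by move: y'_gt0 y'_lt y_lt; move: (k * y - `|x|) => y'; lia.
by rewrite pell_unit_mul.
Qed.

Theorem corollary11 (k : int) (hk2 : 2 <= k) (hk3 : k <> 3) :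
  ~ (exists x y : int,
       [/\ 0 < x, 0 < y & x ^+ 2 - (k ^+ 2 - 1) * y ^+ 2 = - 4]).
Proof.
by move=> [x [y [_ y_gt0]]]; apply: pell_neg4_no_solution.
Qed.
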